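(* Let $\mathcal{L}\subseteq\mathrm{Scat}$ be nonempty, downward $\preceq$-closed and ccs. Then there exists a family $\mathcal{F}\subseteq\mathrm{LO}$ of size $\aleph_1$ which is unbounded with respect to $\trianglelefteq^{\mathcal{L}}_{\mathrm{LO}}$. Thus $\mathfrak{b}(\trianglelefteq^{\mathcal{L}}_{\mathrm{LO}})=\aleph_1$.
   Context: Linear orders are reflexive and nonempty. $L\preceq L'$ means there is an embedding $f:L\to L'$, i.e. $x\le_L y\iff f(x)\le_{L'}f(y)$. $\mathrm{LO}\subseteq 2^{\mathbb{N}\times\mathbb{N}}$ is the set of (codes for) linear orders with domain $\mathbb{N}$; $\mathrm{Fin}$ is the set of (codes for) nonempty linear orders on finite subsets of $\mathbb{N}$; $\mathrm{Lin}=\mathrm{Fin}\cup\mathrm{LO}$; $\mathrm{Scat}\subseteq\mathrm{Lin}$ is the set of scattered ones (those $L$ with $\mathbb{Q}\not\preceq L$). A class $\mathcal{L}\subseteq\mathrm{Lin}$ is downward $\preceq$-closed if $K\in\mathrm{Lin}$ and $K\preceq L\in\mathcal{L}$ imply $K\in\mathcal{L}$; membership in $\mathcal{L}$ is meant up to isomorphism. A subset $I$ of a linear order $L$ is convex if $x\le_L y\le_L z$ and $x,z\in I$ imply $y\in I$. For $A,B\subseteq L$ write $A\le_L B$ (resp. $A<_L B$) if $a\le_L b$ (resp. $a<_L b$) for all $a\in A$, $b\in B$. A $K$-convex partition of $L$ is a partition $(L_k)_{k\in K}$ of $L$ (into nonempty sets) such that $k<_K k'\iff L_k<_L L_{k'}$.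 The relation $L\trianglelefteq^{\mathcal{L}}L'$ holds iff there are $K\in\mathcal{L}$, a $K$-convex partition $(L_k)_{k\in K}$ of $L$, and an embedding $f$ of $L$ into $L'$ such that $f(L_k)$ is a convex subset of $L'$ for every $k\in K$. $\trianglelefteq^{\mathcal{L}}_{\mathrm{LO}}$ is its restriction to $\mathrm{LO}$. $\mathcal{L}$ is ccs (closed under convex sums) if for all $K,K'\in\mathcal{L}$ and every family $(K'_k)_{k\in K}$ of nonempty convex subsets of $K'$ such that $k_0<_K k_1\Rightarrow K'_{k_0}\le_{K'}K'_{k_1}$, we have $\sum_{k\in K}K'_k\in\mathcal{L}$, where $\sum_{k\in K}K'_k=\{(x,k): k\in K, x\in K'_k\}$ ordered antilexicographically. When $\mathcal{L}$ is ccs, $\trianglelefteq^{\mathcal{L}}$ is a quasi-order. For a quasi-order $\precsim$ on $X$, a set $\mathcal{F}\subseteq X$ is unbounded if there is no $x\in X$ with $y\precsim x$ for all $y\in\mathcal{F}$; the unbounding number $\mathfrak{b}(\precsim)$ is the least size of an unbounded subset of $X$. *)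

(* Defs.v *)
From mathcomp Require Import all_boot all_order all_algebra.
From mathcomp Require Import all_classical.

Set Implicit Arguments.
Unset Strict Implicit.
Unset Printing Implicit Defensive.

Import Order.TTheory GRing.Theory Num.Theory.

Local Open Scope classical_set_scope.
Local Open Scope card_scope.

(* A linear order on a subset of T is coded by its reflexive boolean relation
   r : rel T, so that its domain is recovered as {x | r x x}. *)
Definition dom (T : Type) (r : rel T) : set T := [set x | r x x].

Definition linear_order (T : Type) (r : rel T) : Prop :=
  [/\ (forall x y, r x y -> dom r x /\ dom r y),
      antisymmetric r,
      transitive r &
      (forall x y, dom r x -> dom r y -> r x y || r y x)].

Definition strict (T : eqType) (r : rel T) : rel T :=
  fun x y => (x != y) && r x y.

(* For x in dom r the condition on (x, x) yields f x \in dom s; the values of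
   f outside dom r are irrelevant. *)
Definition embedding (T U : Type) (r : rel T) (s : rel U) (f : T -> U) : Prop :=
  forall x y, dom r x -> dom r y -> r x y = s (f x) (f y).

Definition embeds (T U : Type) (r : rel T) (s : rel U) : Prop :=
  exists f : T -> U, embedding r s f.

Definition isomorphic (T U : Type) (r : rel T) (s : rel U) : Prop :=
  exists2 f : T -> U, embedding r s f & f @` dom r = dom s.

Definition LO : set (rel nat) :=
  [set L | linear_order L /\ dom L = setT].

Definition Fin : set (rel nat) :=
  [set L | [/\ linear_order L, dom L !=set0 & finite_set (dom L)]].

Definition Lin : set (rel nat) := Fin `|` LO.

Definition rat_order : rel rat := fun p q => (p <= q)%R.

Definition Scat : set (rel nat) :=
  [set L | Lin L /\ ~ embeds rat_order L].

Definition downward_closed (Lc : set (rel nat)) : Prop :=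
  forall K L, Lin K -> Lc L -> embeds K L -> Lc K.

Definition convex_in (T : Type) (r : rel T) (I : set T) : Prop :=
  I `<=` dom r /\ forall x y z, r x y -> r y z -> I x -> I z -> I y.

Definition set_le (T : Type) (r : rel T) (A B : set T) : Prop :=
  forall a b, A a -> B b -> r a b.

(* [partition] includes the nonemptiness of each P k for k in dom K. *)
Definition convex_partition (K L : rel nat) (P : nat -> set nat) : Prop :=
  partition (dom K) P (dom L) /\
  forall k k', dom K k -> dom K k' ->
    strict K k k' <-> set_le (strict L) (P k) (P k').

Definition convex_embeds (Lc : set (rel nat)) (L L' : rel nat) : Prop :=
  exists K : rel nat, exists P : nat -> set nat, exists f : nat -> nat,
    [/\ Lc K, convex_partition K L P, embedding L L' f &
        forall k, dom K k -> convex_in L' (f @` P k)].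

(* The sum over k in K of the suborders C k of K', on pairs (x, k), ordered
   antilexicographically. *)
Definition convex_sum (K K' : rel nat) (C : nat -> set nat) : rel (nat * nat) :=
  fun p q =>
    [&& p.2 \in dom K, p.1 \in C p.2, q.2 \in dom K, q.1 \in C q.2 &
        strict K p.2 q.2 || ((p.2 == q.2) && K' p.1 q.1)].

(* The sum lives on a subset of nat * nat, so its membership in Lc is read up
   to isomorphism. *)
Definition ccs (Lc : set (rel nat)) : Prop :=
  forall (K K' : rel nat) (C : nat -> set nat),
    Lc K -> Lc K' ->
    (forall k, dom K k -> C k !=set0 /\ convex_in K' (C k)) ->
    (forall k0 k1, dom K k0 -> dom K k1 -> strict K k0 k1 ->
       set_le K' (C k0) (C k1)) ->
    exists2 M, Lc M & isomorphic M (convex_sum K K' C).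

Definition unbounded (T : Type) (X : set T) (R : T -> T -> Prop) (F : set T) :
    Prop :=
  F `<=` X /\ ~ exists2 x, X x & forall y, F y -> R y x.

(* Cardinals are represented by sets having that cardinality. *)
Definition is_unbounding_number (T U : Type) (X : set T) (R : T -> T -> Prop)
    (kappa : set U) : Prop :=
  (exists2 F, unbounded X R F & F #= kappa) /\
  (forall F, unbounded X R F -> kappa #<= F).

Definition well_ordering (W : rel nat) : Prop :=
  linear_order W /\
  forall A : set nat, A `<=` dom W -> A !=set0 ->
    exists2 m, A m & forall a, A a -> W m a.

(* The countable ordinals, each represented by the class of all well-orders of
   subsets of nat of that type: this set has cardinality aleph_1 (it is the
   Hartogs number of nat). *)
Definition aleph1 : set (set (rel nat)) :=
  [set c | exists2 W, well_ordering W &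
             c = [set W' | well_ordering W' /\ isomorphic W W']].

(* Main.v *)
Require Import Defs.
From mathcomp Require Import all_boot all_order all_algebra.
From mathcomp Require Import all_classical.
From mathcomp Require Import wochoice.
Local Open Scope classical_set_scope.
Local Open Scope card_scope.

Import Order.TTheory.

(** Everything rests on orders of the form L_W = the sum over q in Q of copies
of 1 + W, where W is a countable well-order; there are at most aleph_1 of them.

They are unbounded.  Suppose that every L_W embeds piecewise convexly into a
countable L', with pieces indexed by a scattered K.  If the bottoms of
distinct copies of 1 + W always lay in distinct pieces, then Q would embed into
K; so one piece contains the bottoms of two copies q < q', hence everything
between them, and its image is convex in L' ([convex_partition_nonscattered]).
Let x be the image of the bottom of the copy q.  A point y > x of L' lies in
the image of the W of that copy iff the interval (x, y] is well-ordered, because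
any interval that reaches further contains the bottoms of a dense set of copies
([wo_above_lexsum_rat]).  So x determines W up to isomorphism, and the countable
ordinals inject into L'.  This is absurd: if W_0, W_1, ... represented all of
them, the sum over n of the 1 + W_n would be some W_m and would embed into its
own m-th summand, contradicting the rigidity of well-orders
([aleph1_uncountable]).

A countable family is bounded, each member being a convex subset of the sum
over n in N of all of them ([countable_bounded]).  So an unbounded family is
uncountable, and an uncountable set contains a copy of aleph_1: after
well-ordering it, every countable well-order is isomorphic to one of its proper
initial segments ([uncountable_aleph1_le]).  Applied to the family of the L_W,
this also gives that its size is exactly aleph_1, without comparing L_W for
distinct W. *)

Set Implicit Arguments.
Unset Strict Implicit.
Unset Printing Implicit Defensive.

(** * Embeddings, isomorphisms and well-orders *)

Lemma embedding_dom (T U : Type) (r : rel T) (s : rel U) (f : T -> U) x :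
  embedding r s f -> dom r x -> dom s (f x).
Proof. by move=> fE rx; rewrite /dom /= -fE. Qed.

Lemma embedding_inj (T U : Type) (r : rel T) (s : rel U) (f : T -> U) x y :
  antisymmetric r -> embedding r s f -> dom r x -> dom r y -> f x = f y ->
  x = y.
Proof.
move=> rA fE rx ry fxy; apply: rA; rewrite !fE // fxy.
by have := embedding_dom fE ry; rewrite /dom /= => ->.
Qed.

Lemma isomorphic_refl (T : Type) (r : rel T) : isomorphic r r.
Proof. by exists id => //; rewrite image_id. Qed.

Lemma isomorphic_trans (T U V : Type) (r : rel T) (s : rel U) (t : rel V) :
  isomorphic r s -> isomorphic s t -> isomorphic r t.
Proof.
move=> [f fE fD] [g gE gD]; exists (g \o f).
  by move=> x y rx ry /=; rewrite fE // gE //; exact: embedding_dom fE _.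
by rewrite -gD -fD image_comp.
Qed.

(** The order s lives on nat so that the inverse of its isomorphism has default
values outside the domain of t. *)
Lemma isomorphic_common (T U : Type) (r : rel T) (s : rel nat) (t : rel U) :
  antisymmetric s -> isomorphic r t -> isomorphic s t -> isomorphic r s.
Proof.
move=> sA [f fE fD] [g gE gD].
have ginv u : exists x, dom t u -> dom s x /\ g x = u.
  have [tu|] := pselect (dom t u); last by exists 0%N.
  by move: tu; rewrite -gD => -[x sx gx]; exists x.
have [h hP] := choice ginv.
have hP' x : dom r x -> dom s (h (f x)) /\ g (h (f x)) = f x.
  by move=> rx; apply: hP; exact: embedding_dom fE rx.
exists (h \o f) => [x y rx ry /=|].
  have [sx gx] := hP' x rx; have [sy gy] := hP' y ry.
  by rewrite fE // -{1}gx -{1}gy gE.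
rewrite predeqE => y; split=> [[x rx <-]|sy]; first by have [] := hP' x rx.
have : dom t (g y) by exact: embedding_dom gE sy.
rewrite -{1}fD => -[x rx fx]; exists x => //=.
have [sx gx] := hP' x rx.
by apply: (embedding_inj sA gE); rewrite // gx.
Qed.

Lemma isomorphic_sym (T : Type) (r : rel nat) (s : rel T) :
  antisymmetric r -> isomorphic r s -> isomorphic s r.
Proof.
by move=> rA rs; apply: isomorphic_common rs => //; exact: isomorphic_refl.
Qed.

Lemma linear_orderN (T : eqType) (r : rel T) x y : linear_order r ->
  dom r x -> dom r y -> ~~ r x y = strict r y x.
Proof.
move=> [_ rA _ rT] rx ry; rewrite /strict.
have [->|yx] /= := eqVneq y x; first by rewrite (rx : r x x).
apply/idP/idP => [nxy|ryx]; first by have := rT x y rx ry; rewrite (negbTE nxy).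
by apply/negP => rxy; move/eqP: yx; apply; apply: rA; rewrite ryx.
Qed.

(** Well-orders on a subset of an arbitrary type; on nat this unfolds to
[well_ordering]. *)
Definition well_ordered (T : Type) (r : rel T) : Prop :=
  linear_order r /\
  forall A : set T, A `<=` dom r -> A !=set0 ->
    exists2 m, A m & forall a, A a -> r m a.

(** A self-embedding of a well-order moves no point down. *)
Lemma well_ordered_rigid (T : Type) (r : rel T) (f : T -> T) x :
  well_ordered r -> embedding r r f -> dom r x -> r x (f x).
Proof.
move=> [[_ rA rTr rT] rW] fE rx; apply: contrapT => nx.
have [||m [rm nm] mmin] := rW [set y | dom r y /\ ~ r y (f y)]; last 1 first.
- have fm : dom r (f m) := embedding_dom fE rm.
  have rfm : r (f m) m by have /orP[|//] := rT (f m) m fm rm.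
  apply/nm/mmin; split=> // fmffm; apply: nm.
  have e : f (f m) = f m by apply: rA; rewrite -fE // rfm.
  by rewrite fE // e.
- by move=> y [].
- by exists x.
Qed.

(** * Lexicographic sums *)

(** The order 1 + r, with bottom [None]. *)
Definition below (r : rel nat) : rel (option nat) := fun u v =>
  match u, v with
  | None, None => true
  | None, Some y => r y y
  | Some x, Some y => r x y
  | Some _, None => false
  end.

(** The sum over i in I of the orders 1 + R i, on pairs (point, index) compared
by index first.  The added bottoms make every summand nonempty, and the sum
infinite when I is. *)
Definition lexsum d (I : orderType d) (R : I -> rel nat) :
    rel (option nat * I) := fun p q =>
  [&& below (R p.2) p.1 p.1, below (R q.2) q.1 q.1 &
      (p.2 < q.2)%O || ((p.2 == q.2) && below (R p.2) p.1 q.1)].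

Lemma linear_order_below r : linear_order r -> linear_order (below r).
Proof.
move=> [rD rA rTr rT]; split.
- by move=> [x|] [y|] //=; exact: rD.
- by move=> [x|] [y|] //=; [move=> /rA ->|rewrite andbF].
- by move=> [y|] [x|] [z|] //=; [exact: rTr|move=> _ /rD[]].
- by move=> [x|] [y|]; rewrite /dom //=; [exact: rT|move=> _ ->].
Qed.

Section LexSum.
Context {d : Order.disp_t} {I : orderType d} (R : I -> rel nat).
Hypothesis R_lin : forall i, linear_order (R i).
Implicit Types p q : option nat * I.

Lemma dom_lexsum p : dom (lexsum R) p = dom (below (R p.2)) p.1.
Proof. by rewrite /dom /lexsum /= eqxx ltxx /= !andbb. Qed.

Lemma lexsumE p q : dom (lexsum R) p -> dom (lexsum R) q ->
  lexsum R p q = (p.2 < q.2)%O || ((p.2 == q.2) && below (R p.2) p.1 q.1).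
Proof. by rewrite !dom_lexsum /dom /lexsum => /= -> ->. Qed.

Lemma dom_lexsum_None i : dom (lexsum R) (None, i).
Proof. by rewrite dom_lexsum. Qed.

Lemma lexsum_le2 p q : lexsum R p q -> (p.2 <= q.2)%O.
Proof. by move=> /and3P[_ _ /orP[/ltW//|/andP[/eqP-> _]]]. Qed.

Lemma linear_order_lexsum : linear_order (lexsum R).
Proof.
have RB i := linear_order_below (R_lin i).
split.
- by move=> p q /and3P[pp qq _]; rewrite !dom_lexsum.
- move=> [x i] [y j] /andP[pq qp].
  have /= ij : i = j.
    by apply/eqP; rewrite eq_le (lexsum_le2 pq) (lexsum_le2 qp).
  move: pq qp; rewrite ij /lexsum /= ltxx eqxx /=.
  move=> /and3P[_ _ xy] /and3P[_ _ yx].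
  by have [_ rA _ _] := RB j; congr pair; apply: rA; rewrite xy yx.
- move=> [y j] [x i] [z k] /and3P[/= xx yy xy] /and3P[/= _ zz yz].
  rewrite /lexsum /= xx zz /=.
  case/orP: xy => [ij|/andP[/eqP ij xy]];
    case/orP: yz => [jk|/andP[/eqP jk yz]].
  + by rewrite (lt_trans ij jk).
  + by rewrite -jk ij.
  + by rewrite ij jk.
  + subst; rewrite eqxx /=; have [_ _ rTr _] := RB k.
    by rewrite (rTr _ _ _ xy yz) orbT.
- move=> p q pD qD; rewrite !lexsumE //.
  have [//|//|ij] := ltgtP p.2 q.2; rewrite /= -ij.
  move: pD qD; rewrite !dom_lexsum -ij; have [_ _ _ rT] := RB p.2.
  exact: rT.
Qed.

Lemma countable_lexsum : countable [set: I] -> countable (dom (lexsum R)).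
Proof.
move=> Ic; apply: (@sub_countable _ _ _ ([set: option nat] `*` [set: I])).
  exact: subset_card_le.
exact: countableX.
Qed.

Lemma infinite_lexsum : infinite_set [set: I] -> infinite_set (dom (lexsum R)).
Proof.
move=> /infiniteP Ii; apply/infiniteP; apply: card_le_trans Ii _.
have h : {in [set: I] &, injective (fun i : I => (None : option nat, i))}.
  by move=> i j _ _ [].
have := inj_card_eq h; rewrite card_eq_le => /andP[_ /card_le_trans]; apply.
by apply: subset_card_le => _ [i _ <-]; exact: dom_lexsum_None.
Qed.
End LexSum.

(** A countably infinite linear order is isomorphic to one with domain nat. *)
Lemma LO_numbering (T : Type) (r : rel T) :
  linear_order r -> countable (dom r) -> infinite_set (dom r) ->
  exists2 L, LO L & isomorphic r L.
Proof.
move=> [rD rA rTr rT] rc ri.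
have /card_set_bijP[f [fD finj fsurj]] := eq_card_nat rc ri.
have /choice[e eP] : forall n, exists x, dom r x /\ f x = n.
  by move=> n; have [x rx <-] := fsurj n I; exists x.
have eD n : dom r (e n) by case: (eP n).
have fe n : f (e n) = n by case: (eP n).
have ef x : dom r x -> e (f x) = x.
  by move=> rx; apply: finj; rewrite ?inE // fe.
have LT : dom (fun m n => r (e m) (e n)) = setT.
  by rewrite predeqE => n; split=> // _; exact: eD.
exists (fun m n => r (e m) (e n)).
  split=> //; split.
  - by move=> m n _; rewrite LT.
  - by move=> m n /rA emn; rewrite -(fe m) -(fe n) emn.
  - by move=> n m k; exact: rTr.
  - by move=> m n _ _; exact: rT.
exists f; first by move=> x y rx ry; rewrite !ef.
by rewrite LT predeqE => n; split=> // _; exists (e n).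
Qed.

Lemma lexsum_numbering d (I : orderType d) (R : I -> rel nat) :
  countable [set: I] -> infinite_set [set: I] ->
  (forall i, linear_order (R i)) ->
  exists2 L, LO L & isomorphic (lexsum R) L.
Proof.
move=> Ic Ii Rl; apply: LO_numbering; first exact: linear_order_lexsum.
  exact: countable_lexsum.
exact: infinite_lexsum.
Qed.

(** * The countable ordinals *)

(** The element of [aleph1] represented by W. *)
Definition otype (W : rel nat) : set (rel nat) :=
  [set W' | well_ordering W' /\ isomorphic W W'].

Lemma otype_eq W W' : well_ordering W -> well_ordering W' ->
  otype W = otype W' <-> isomorphic W W'.
Proof.
move=> WW WW'; have [[_ WA _ _] _] := WW; split=> [e|i].
  have : otype W' W' by split=> //; exact: isomorphic_refl.
  by rewrite -e => -[].
rewrite predeqE => V; split=> -[WV iV]; split=> //.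
  by apply: isomorphic_trans iV; exact: isomorphic_sym.
exact: isomorphic_trans iV.
Qed.

Lemma well_ordered_isomorphic (T U : Type) (r : rel T) (s : rel U) :
  linear_order s -> isomorphic r s -> well_ordered r -> well_ordered s.
Proof.
move=> sL [f fE fD] [rL rW]; split=> // A AD [a Aa].
have [||m [rm Am] mmin] := rW [set x | dom r x /\ A (f x)].
- by move=> x [].
- have := AD _ Aa; rewrite -fD => -[x rx fx].
  by exists x; split=> //; rewrite fx.
exists (f m) => // b Ab; have := AD _ Ab; rewrite -fD => -[x rx fx].
by rewrite -fx -fE //; apply: mmin; rewrite /= fx.
Qed.

Lemma well_ordered_lexsum_nat (R : nat -> rel nat) :
  (forall n, well_ordered (R n)) -> well_ordered (lexsum R).
Proof.
move=> RW; have Rl n : linear_order (R n) by case: (RW n).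
split; first exact: linear_order_lexsum.
move=> A AD [[x0 n0] A0].
have ex : exists n, `[< exists x, A (x, n) >].
  by exists n0; apply/asboolP; exists x0.
case: (ex_minnP ex) => n /asboolP[x Ax] nmin.
have {}nmin p : A p -> (n <= p.2)%N.
  by case: p => y k Ap; apply: nmin; apply/asboolP; exists y.
suff [y Ay ymin] : exists2 y, A (y, n) &
    forall z, A (z, n) -> below (R n) y z.
  exists (y, n) => // -[z k] Ak; rewrite lexsumE //=; try exact: AD.
  have := nmin _ Ak; rewrite leq_eqVlt => /orP[/eqP/= e|/= nk].
    by subst k; rewrite eqxx ymin // orbT.
  by rewrite ltEnat /= nk.
have [AN|AN] := pselect (A (None, n)).
  exists None => // -[z|//] /AD; rewrite dom_lexsum //.
have [||m Am mmin] := (proj2 (RW n)) [set y | A (Some y, n)].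
- by move=> y /AD; rewrite dom_lexsum.
- by case: x Ax => // x Ax; exists x.
by exists (Some m) => // -[z|//] Az; exact: mmin.
Qed.

(** The Burali-Forti argument, applied to a sum of representatives. *)
Lemma aleph1_uncountable : ~ countable aleph1.
Proof.
move=> /pcard_surjP[g gS].
have /choice[V VP] : forall n, exists V, well_ordering V /\
    (aleph1 (g n) -> g n = otype V).
  move=> n; have [[W WW gW]|ng] := pselect (aleph1 (g n)); first by exists W.
  exists (fun _ _ => false); split=> //.
  by split; [split|move=> A AD [a /AD]].
have VW n : well_ordering (V n) by case: (VP n).
have Vl n : linear_order (V n) by case: (VW n).
have SW := well_ordered_lexsum_nat VW.
have [L [Ll _] SL] :=
  lexsum_numbering (I := nat) (countableP _) infinite_nat Vl.
have LW : well_ordering L := well_ordered_isomorphic Ll SL SW.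
have [m _ gm] : [set g n | n in setT] (otype L).
  by apply: gS; exists L.
have /(proj2 (VP m)) : aleph1 (g m) by rewrite gm; exists L.
rewrite gm => /(otype_eq LW (VW m)) LV.
have [f fE fD] := isomorphic_trans SL LV.
(* The sum embeds into its m-th summand, so it moves the bottom of the next
   summand down. *)
pose h p : option nat * nat := (Some (f p), m).
have hD p : dom (lexsum V) p -> dom (lexsum V) (h p).
  by move=> pD; rewrite dom_lexsum; exact: (embedding_dom fE pD : V m _ _).
have hE : embedding (lexsum V) (lexsum V) h.
  move=> p q pD qD; rewrite (lexsumE (hD _ pD) (hD _ qD)) /=.
  by rewrite ltxx eqxx /= -fE.
have tD := dom_lexsum_None V m.+1.
have := well_ordered_rigid SW hE tD.
by move=> /lexsum_le2 /=; rewrite leEnat ltnn.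
Qed.

Lemma well_ordering_wf W : well_ordering W -> well_founded (strict W).
Proof.
move=> [[WD WA _ _] WW] w; apply: contrapT => nw.
have nAcc v : ~ Acc (strict W) v ->
    dom W v /\ exists2 u, strict W u v & ~ Acc (strict W) u.
  move=> nv.
  have [u uv nu] : exists2 u, strict W u v & ~ Acc (strict W) u.
    apply: contrapT => nex; apply: nv; constructor => u uv.
    by apply: contrapT => nu; apply: nex; exists u.
  by split; [have /andP[_ /WD[]] := uv|exists u].
have [||m nm mmin] := WW [set v | ~ Acc (strict W) v].
- by move=> v /nAcc[].
- by exists w.
have [_ [u /andP[/eqP um Wum] nu]] := nAcc m nm.
by apply: um; apply: WA; rewrite Wum mmin.
Qed.

(** Transfinite recursion along W, for a value that depends only on the set of
earlier values. *)
Lemma well_ordering_rec (T : Type) (W : rel nat) (mu : set T -> T) :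
  well_ordering W ->
  exists g : nat -> T, forall w, g w = mu (g @` [set v | strict W v w]).
Proof.
move=> /well_ordering_wf wf.
pose F (w : nat) (rec : forall v, strict W v w -> T) :=
  mu [set b | exists v, exists h : strict W v w, rec v h = b].
exists (Fix wf (fun=> T) F) => w; rewrite Fix_eq.
  congr mu; rewrite predeqE => b.
  split=> [[v [h <-]]|[v /= h <-]]; first by exists v.
  by exists v, h.
move=> {}w f1 f2 f12; congr mu; rewrite predeqE => b.
by split=> -[v [h <-]]; exists v, h.
Qed.

(** The suborder of r on A. *)
Definition restr (T : Type) (A : set T) (r : rel T) : rel T :=
  fun x y => [&& `[< A x >], `[< A y >] & r x y].

Lemma dom_restr (T : Type) (A : set T) (r : rel T) :
  dom (restr A r) = A `&` dom r.
Proof.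
rewrite predeqE => x; split=> [/and3P[/asboolP Ax _ rx]|[Ax rx]].
  by split.
by rewrite /dom /restr /= !asboolT.
Qed.

Lemma uncountable_aleph1_le (T : Type) (F : set T) :
  ~ countable F -> aleph1 #<= F.
Proof.
elim/Peq: T => T in F *.
move=> Fc.
have [R RW] := well_ordering_principle T.
have Rmin (A : set T) : A !=set0 -> exists2 m, A m & forall a, A a -> R m a.
  move=> [a Aa]; have [|m [[Am mmin] _]] := RW [pred x | `[< A x >]].
    by exists a; apply/asboolP.
  by exists m; [exact/asboolP|move=> b Ab; apply: mmin; apply/asboolP].
have RA : antisymmetric R.
  by move=> x y; apply: (wo_chain_antisymmetric (withinW RW)).
have [t0 _] : F !=set0.
  apply: contrapT => F0; apply: Fc; suff -> : F = set0 by [].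
  by rewrite predeqE => x; split=> // Fx; apply: F0; exists x.
(* mu A is the least element of F outside the countable set A.  Iterating mu
   along W enumerates an initial segment of F in order: the predecessors of mu
   of the image of W. *)
have /choice[mu muP] : forall A : set T, exists m,
    countable A -> [/\ F m, ~ A m & forall b, F b -> ~ A b -> R m b].
  move=> A; have [Ac|] := pselect (countable A); last by exists t0.
  have [|m [Fm nAm] mmin] := Rmin (F `\` A).
    apply: contrapT => FA; apply: Fc; apply: sub_countable Ac.
    apply: subset_card_le => x Fx; apply: contrapT => nAx; apply: FA.
    by exists x.
  by exists m => _; split=> // b Fb nAb; apply: mmin.
pose seg a := [set b | [/\ F b, R b a & b != a]].
have init W : well_ordering W -> exists2 a, F a &
    isomorphic W (restr (seg a) R).
  move=> WW; have [g gE] := well_ordering_rec mu WW.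
  have [[WD WA WTr WT] _] := WW.
  have gc (A : set nat) : countable (g @` A).
    exact: sub_countable (card_image_le _ _) _.
  have gP w : [/\ F (g w), ~ (g @` [set v | strict W v w]) (g w) &
      forall b, F b -> ~ (g @` [set v | strict W v w]) b -> R (g w) b].
    by have := muP _ (gc [set v | strict W v w]); rewrite -gE.
  have [Fa na amin] := muP _ (gc (dom W)).
  set a := mu _ in Fa na amin.
  have gmono v w : strict W v w -> R (g v) (g w) && (g v != g w).
    move=> vw; have [Fv nv vmin] := gP v; have [Fw nw _] := gP w.
    apply/andP; split; last by apply/eqP => e; apply: nw; exists v.
    apply: vmin => // -[u /= uv guw]; apply: nw; exists u => //=.
    move: uv vw => /andP[uv Wuv] /andP[vw Wvw].
    rewrite /strict (WTr _ _ _ Wuv Wvw) andbT; apply: contra_neq uv => uw.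
    by apply: WA; rewrite Wuv uw.
  have gW w : dom W w -> seg a (g w).
    move=> Ww; have [Fw nw wmin] := gP w; split=> //; last first.
      by apply/eqP => e; apply: na; exists w.
    apply: wmin => // -[v /= /andP[_ /WD[Wv _]] gva].
    by apply: na; exists v.
  have Rrefl x : R x x.
    by have [|m -> ] := Rmin [set x]; [exists x|apply].
  exists a => //; exists g => [v w Wv Ww|].
    rewrite /restr !asboolT /=; [|exact: gW..].
    have [->|vw] := eqVneq v w; first by rewrite Rrefl.
    have [vw'|nvw] := boolP (W v w).
      by have /andP[-> _] : R (g v) (g w) && (g v != g w) by apply/gmono/andP.
    have /orP[|Wwv] := WT v w Wv Ww; first by rewrite (negbTE nvw).
    have /andP[gwv ne] : R (g w) (g v) && (g w != g v).
      by apply/gmono/andP; rewrite eq_sym.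
    by apply/esym/negP => gvw; move/eqP: ne; apply; apply: RA; rewrite gwv.
  rewrite predeqE => b; split=> [[w Ww <-]|].
    by rewrite dom_restr; split; [exact: gW|exact: Rrefl].
  rewrite dom_restr => -[[Fb ba nba] _].
  apply: contrapT => nb; move/eqP: nba; apply; apply: RA.
  by rewrite ba amin.
have /choice[phi phiP] : forall c, exists a, aleph1 c -> F a /\
    exists2 W, well_ordering W /\ c = otype W & isomorphic W (restr (seg a) R).
  move=> c; have [[W WW cW]|] := pselect (aleph1 c); last by exists t0.
  by have [a Fa Wa] := init W WW; exists a => _; split=> //; exists W.
have phi_inj : {in aleph1 &, injective phi}.
  move=> c c'; rewrite !inE.
  move=> /phiP[_ [W [WW ->] iW]] /phiP[_ [W' [WW' ->] iW']] e.
  apply/(otype_eq WW WW'); rewrite -e in iW'.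
  by apply: isomorphic_common iW iW'; case: WW' => -[].
have := inj_card_eq phi_inj.
rewrite card_eq_le => /andP[_ /card_le_trans]; apply.
by apply: subset_card_le => _ [c /phiP[Fc' _] <-].
Qed.

(** * Recovering a well-order from a point *)

(** The points y > x of L such that the interval (x, y] is well-ordered. *)
Definition wo_above (L : rel nat) (x : nat) : set nat :=
  [set y | strict L x y /\
    well_ordered (restr [set z | strict L x z /\ L z y] L)].

Lemma linear_order_restr (T : Type) (A : set T) (r : rel T) :
  linear_order r -> linear_order (restr A r).
Proof.
move=> [rD rA rTr rT]; split.
- move=> x y /and3P[/asboolP Ax /asboolP Ay /rD[rx ry]].
  by rewrite dom_restr; split.
- by move=> x y /andP[/and3P[_ _ xy] /and3P[_ _ yx]]; apply: rA; rewrite xy yx.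
- move=> y x z /and3P[Ax _ xy] /and3P[_ Az yz].
  by rewrite /restr Ax Az (rTr _ _ _ xy yz).
- move=> x y; rewrite dom_restr => -[Ax rx] [Ay ry].
  by rewrite /restr !asboolT //= rT.
Qed.

Lemma wo_aboveP (L : rel nat) (x y : nat) : linear_order L -> wo_above L x y <->
  strict L x y /\
  forall A, A `<=` [set z | strict L x z /\ L z y] -> A !=set0 ->
    exists2 m, A m & forall a, A a -> L m a.
Proof.
move=> Ll; have [LD _ _ _] := Ll; split=> -[xy H]; split=> //.
  move=> A AS A0; have [||m Am mmin] := H.2 A => //.
    move=> z /AS[xz zy]; rewrite dom_restr; split=> //.
    by have [] := LD _ _ zy.
  by exists m => // a /mmin/and3P[].
split; first exact: linear_order_restr.
move=> A; rewrite dom_restr => AS A0; have [||m Am mmin] := H A => //.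
  by move=> z /AS[].
exists m => // a Aa; rewrite /restr (mmin _ Aa).
by rewrite !asboolT //; apply/(fun u Au => (AS u Au).1).
Qed.

(** A bottom of a copy of 1 + W remembers W in any order where an interval above
it is exactly as in the sum: by the last hypothesis, phi reaches every point of
L between the images of the bottoms of the copies q and q'. *)
Lemma wo_above_lexsum_rat (W L : rel nat) (phi : option nat * rat -> nat)
    (q q' : rat) :
  well_ordering W -> linear_order L ->
  embedding (lexsum (fun _ : rat => W)) L phi ->
  (q < q')%O ->
  (forall y, L (phi (None, q)) y -> L y (phi (None, q')) ->
     exists2 p, dom (lexsum (fun _ : rat => W)) p & phi p = y) ->
  isomorphic W (restr (wo_above L (phi (None, q))) L).
Proof.
move=> WW Ll phiE qq' conv; have [Wl Wmin] := WW.
have [_ _ LTr _] := Ll.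
set D := lexsum _ in phiE conv.
have DE p p' : dom D p -> dom D p' ->
    D p p' = (p.2 < p'.2)%O || ((p.2 == p'.2) && below W p.1 p'.1).
  exact: lexsumE.
have DD p : dom D p = dom (below W) p.1 by exact: dom_lexsum.
have Dl : linear_order D by exact: linear_order_lexsum.
have DN s : dom D (None, s) by exact: dom_lexsum_None.
have DW w s : dom W w -> dom D (Some w, s) by move=> Ww; rewrite DD.
have phiD p : dom D p -> dom L (phi p) by exact: embedding_dom.
have phiS p p' : dom D p -> dom D p' ->
    strict L (phi p) (phi p') = strict D p p'.
  move=> Dp Dp'; rewrite -(linear_orderN Ll); [|exact: phiD..].
  by rewrite -(linear_orderN Dl) // phiE.
set x := phi (None, q) in conv *.
have strD p : dom D p ->
    strict D (None, q) p = (q < p.2)%O || (p.2 == q) && (p.1 != None).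
  move=> Dp; rewrite /strict DE //=.
  case: p Dp => [[w|] s] Dp /=.
    have -> : W w w by move: Dp; rewrite DD.
    by congr (_ || (_ && _)); exact: eq_sym.
  rewrite andbF andbT orbF xpair_eqE /=.
  by case: (ltgtP q s).
have inW w : dom W w -> wo_above L x (phi (Some w, q)).
  move=> Ww; apply/(wo_aboveP _ _ Ll); split.
    by rewrite phiS ?strD //=; [rewrite eqxx orbT|exact: DW..].
  move=> A AS A0.
  have AW z : A z -> exists2 v, dom W v & z = phi (Some v, q).
    move=> /AS[xz zw]; have [||p Dp pz] := conv z.
    - by have /andP[] := xz.
    - apply: LTr zw _; rewrite -phiE ?DE /= ?qq' //; exact: DW.
    move: xz zw; rewrite -pz phiS // strD // -phiE //; last exact: DW.
    move=> /orP[qp /lexsum_le2 /=|]; first by rewrite leNgt qp.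
    case: p Dp {pz} => [[v|] s] /= Dp /andP[/eqP-> //] _ _.
    by exists v => //; move: Dp; rewrite DD.
  have [||m Am mmin] := Wmin [set v | dom W v /\ A (phi (Some v, q))].
  - by move=> v [].
  - by have [z Az] := A0; have [v Wv zv] := AW z Az; exists v; rewrite /= -zv.
  have [Wm Aphi] := Am.
  exists (phi (Some m, q)) => // a Aa; have [v Wv av] := AW a Aa.
  rewrite av -phiE ?DE //= ?ltxx ?eqxx /=; try exact: DW.
  by apply: mmin; rewrite /= -av.
(* The bottoms of the copies strictly between q and s have no least element. *)
have notwo y s : (q < s)%O -> L (phi (None, s)) y -> ~ wo_above L x y.
  move=> qs sy /(wo_aboveP _ _ Ll)[_ ymin].
  have [||_ [t /= qt <-] tmin] :=
      ymin [set phi (None, t) | t in [set t : rat | (q < t)%O && (t < s)%O]].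
  - move=> _ [t /andP[qt ts] <-]; split; first by rewrite phiS ?strD //= qt.
    by apply: LTr sy; rewrite -phiE ?DE //= ts.
  - exists (phi (None, (q + s) / 2)%R), ((q + s) / 2)%R => //=.
    by rewrite !Num.Theory.midf_lt.
  move/andP: qt => [qt ts].
  have /tmin : [set phi (None, t) | t in [set t : rat | (q < t)%O && (t < s)%O]]
       (phi (None, (q + t) / 2)%R).
    exists ((q + t) / 2)%R => //=; rewrite !Num.Theory.midf_lt //=.
    by rewrite (lt_trans _ ts) // Num.Theory.midf_lt.
  by rewrite -phiE // => /lexsum_le2/=; rewrite leNgt Num.Theory.midf_lt.
exists (fun w => phi (Some w, q)) => [v w Wv Ww|].
  rewrite /restr !asboolT /=; [|exact: inW..].
  by rewrite -phiE ?DE //= ?ltxx ?eqxx //; exact: DW.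
rewrite dom_restr predeqE => y; split=> [[w Ww <-]|[yw yD]].
  by split; [exact: inW|exact/phiD/DW].
have [/andP[_ xy] _] := yw.
have yq' : ~~ L (phi (None, q')) y.
  by apply/negP => h; exact: notwo qq' h yw.
have [||p Dp py] := conv y => //.
  by move: yq'; rewrite (linear_orderN Ll (phiD _ (DN q')) yD) => /andP[].
have : strict D (None, q) p by rewrite -phiS // py; have [] := yw.
rewrite strD // => /orP[qp|].
  exfalso; apply: (notwo y p.2 qp) yw; rewrite -py -phiE // DE //= ltxx eqxx /=.
  by move: Dp; rewrite DD; case: p {py qp} => [[]].
case: p Dp py => [[w|] s] /= Dp py /andP[/eqP sq //] _; subst s.
by exists w => //; move: Dp; rewrite DD.
Qed.

(** In a partition with scattered index order, two points of a copy of Q share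
a piece. *)
Lemma convex_partition_nonscattered (K L : rel nat) (P : nat -> set nat)
    (e : rat -> nat) :
  linear_order K -> ~ embeds rat_order K -> linear_order L ->
  convex_partition K L P -> embedding rat_order L e ->
  exists k, exists q, exists2 q', dom K k &
    [/\ (q < q')%O, P k (e q) & P k (e q')].
Proof.
move=> Kl Ks Ll [[Pcov Ptriv _] Pconv] eE; apply: contrapT => nex.
have ratD q : dom rat_order q by rewrite /dom /rat_order /= lexx.
have /choice[k kP] : forall q, exists k, dom K k /\ P k (e q).
  move=> q; have : dom L (e q) := embedding_dom eE (ratD q).
  by rewrite -Pcov => -[k Kk Pk]; exists k.
have kD q : dom K (k q) by case: (kP q).
have kPe q : P (k q) (e q) by case: (kP q).
have mono q q' : (q < q')%O -> strict K (k q) (k q').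
  move=> qq'; rewrite -linear_orderN //; apply/negP => Kqq'.
  have [kqq'|kqq'] := eqVneq (k q') (k q).
    by apply: nex; exists (k q), q, q'; rewrite ?{2}kqq' // -{2}kqq'; split.
  have /Pconv : strict K (k q') (k q) by rewrite /strict kqq' Kqq'.
  move=> /(_ (kD _) (kD _)) /(_ _ _ (kPe q') (kPe q)) /andP[_].
  by rewrite -eE // /rat_order leNgt qq'.
apply: Ks; exists k => p q _ _; rewrite /rat_order.
have [pq|pq|->] := ltgtP p q.
- by have /andP[_ ->] := mono _ _ pq.
- apply/esym/negP/negP; rewrite linear_orderN //; exact: mono.
- by rewrite (kD q : K _ _).
Qed.

(** * Bounded and unbounded families *)

Lemma countable_bounded (Lc F : set (rel nat)) :
  Lc `<=` Scat -> Lc !=set0 -> downward_closed Lc -> F `<=` LO -> countable F ->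
  exists2 L', LO L' & forall L, F L -> convex_embeds Lc L L'.
Proof.
move=> Lcs [L0 Lc0] Lcd FLO /pcard_surjP[g gS].
have LOleq : LO leq.
  split; last by rewrite predeqE => n; split=> // _; exact: leqnn.
  split=> [m n _| | |m n _ _]; rewrite /dom /= ?leqnn //.
  - exact: anti_leq.
  - exact: leq_trans.
  - exact: leq_total.
have /choice[V VP] : forall n, exists V, LO V /\ (F (g n) -> g n = V).
  move=> n; have [Fg|] := pselect (F (g n)); last by exists leq.
  by exists (g n); split=> //; exact: FLO.
have Vl n : linear_order (V n) by case: (VP n) => -[].
have VT n x : dom (V n) x by case: (VP n) => -[_ ->].
have [L' L'LO [h hE hD]] :=
  lexsum_numbering (I := nat) (countableP _) infinite_nat Vl.
exists L' => // L FL; have [[_ L'A _ _] _] := L'LO.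
have [n _ gn] : [set g n | n in setT] L by exact: gS.
have LV : L = V n by rewrite -gn; apply: (VP n).2; rewrite gn.
(* The one-point order belongs to Lc, so embeddings with convex image suffice. *)
pose K : rel nat := fun a b => (a == 0%N) && (b == 0%N).
have K0 a : dom K a -> a = 0%N by move=> /andP[/eqP].
have LcK : Lc K.
  apply: (Lcd _ L0) => //.
    left; split.
    - split=> [x y /andP[/eqP-> /eqP->] //|
               x y /andP[/andP[/eqP-> /eqP->]] //| |].
      + by move=> y x z /andP[x0 _] /andP[_ z0]; rewrite /K x0.
      + by move=> x y /K0-> /K0->.
    - by exists 0%N.
    - by apply: (@sub_finite_set _ _ [set 0%N]) => // x /K0.
  have [[[L0l [x L0x] _]|[L0l L0T]] _] := Lcs _ Lc0.
    by exists (fun=> x) => a b /K0-> /K0->; rewrite /K /= L0x.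
  have L00 : dom L0 0%N by rewrite L0T.
  by exists (fun=> 0%N) => a b /K0-> /K0->; rewrite /K /= L00.
have hDD x : dom (lexsum V) (Some x, n) by rewrite dom_lexsum; exact: VT.
exists K, (fun=> setT), (fun x => h (Some x, n)); split=> //.
- split; last first.
    move=> k k' /K0-> /K0->; rewrite /strict eqxx /=.
    split=> // /(_ 0%N 0%N I I).
    by rewrite eqxx.
  split; last by exists 0%N.
    rewrite LV; have -> : dom (V n) = setT by case: (VP n) => -[].
    by rewrite predeqE => x; split=> // _; exists 0%N.
  by move=> i j /K0-> /K0->.
- by move=> x y _ _; rewrite LV -hE // lexsumE //= ltxx eqxx.
- move=> k _; split=> [_ [x _ <-]|x y z xy yz [a _ ax] [b _ bz]].
    exact: embedding_dom hE _.
  have [_ L'T] := L'LO.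
  have : dom L' y by rewrite L'T.
  rewrite -hD => -[[u i] pD py].
  move: xy yz; rewrite -ax -bz -py -!hE // => xy yz.
  have /= ni : n = i.
    by apply/eqP; rewrite eq_le (lexsum_le2 xy) (lexsum_le2 yz).
  subst i; move: xy; rewrite lexsumE //= ltxx eqxx /=.
  by case: u pD {yz} py => // c _ _ _; exists c.
Qed.

(** A family that contains, up to isomorphism, the sum over Q of the 1 + W for
some representative W of each countable ordinal has no bound. *)
Lemma rational_sums_unbounded (Lc F : set (rel nat)) :
  Lc `<=` Scat ->
  (forall W, well_ordering W -> exists W' L, [/\ well_ordering W',
      isomorphic W W', F L & isomorphic (lexsum (fun _ : rat => W')) L]) ->
  F `<=` LO -> ~ exists2 L', LO L' & forall L, F L -> convex_embeds Lc L L'.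
Proof.
move=> Lcs FW FLO [L' [L'l L'T] bound]; apply: aleph1_uncountable.
suff /choice[x xP] : forall c, exists x, aleph1 c -> exists W,
    [/\ well_ordering W, c = otype W & isomorphic W (restr (wo_above L' x) L')].
  apply/countable_injP; exists x => c c'; rewrite !inE.
  move=> /xP[W [WW -> iW]] /xP[W' [WW' -> iW']] e.
  apply/(otype_eq WW WW'); rewrite -e in iW'.
  by apply: isomorphic_common iW iW'; case: WW' => -[].
move=> c; have [[W0 WW0 cW]|] := pselect (aleph1 c); last by exists 0%N.
have [W [L [WW W0W FL [h hE hD]]]] := FW W0 WW0.
have [Ll LT] := FLO _ FL; have [Wl _] := WW.
have [K [P [f [LcK Pp fE fconv]]]] := bound _ FL.
have [KLin Ks] := Lcs _ LcK.
have Kl : linear_order K by case: KLin => -[].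
have eE : embedding rat_order L (fun q => h (None, q)).
  move=> p q _ _; rewrite -hE; [|exact: dom_lexsum_None..].
  rewrite lexsumE; [|exact: dom_lexsum_None..].
  by rewrite /= andbT /rat_order le_eqVlt orbC.
have [k [q [q' Kk [qq' Pq Pq']]]] :=
  convex_partition_nonscattered Kl Ks Ll Pp eE.
exists (f (h (None, q))) => _; exists W; split=> //.
  by rewrite cW; apply/otype_eq.
apply: (wo_above_lexsum_rat (phi := f \o h) WW L'l _ qq').
  by move=> p p' Dp Dp'; rewrite /= -fE ?LT // hE.
move=> y /= qy yq'.
have [_ conv] := fconv k Kk.
have [||m Pm <-] := conv _ _ _ qy yq'; [by eexists; [exact: Pq|]|
  by eexists; [exact: Pq'|]|].
have : dom L m by rewrite LT.
by rewrite -hD => -[p Dp <-]; exists p.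
Qed.

Unset Implicit Arguments.

Theorem theorem5p12 (Lc : set (rel nat))
    (Lc_scat : Lc `<=` Scat) (Lc_nonempty : Lc !=set0)
    (Lc_down : downward_closed Lc) (Lc_ccs : ccs Lc) :
  (exists F : set (rel nat),
      [/\ F `<=` LO, F #= aleph1 & unbounded LO (convex_embeds Lc) F]) /\
  is_unbounding_number LO (convex_embeds Lc) aleph1.
Proof.
have lower F : unbounded LO (convex_embeds Lc) F -> aleph1 #<= F.
  move=> [FLO nF]; apply: uncountable_aleph1_le => Fc; apply: nF.
  exact: countable_bounded.
suff [F [FLO Fle nF]] : exists F,
    [/\ F `<=` LO, F #<= aleph1 & unbounded LO (convex_embeds Lc) F].
  have FE : F #= aleph1 by rewrite card_eq_le Fle lower.
  by split; [exists F|split=> //; exists F].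
have /choice[Q QP] : forall c, exists L, aleph1 c -> exists W, [/\ c = otype W,
    well_ordering W, LO L & isomorphic (lexsum (fun _ : rat => W)) L].
  move=> c; have [[W WW cW]|] := pselect (aleph1 c); last by exists leq.
  have [L LLO iL] := lexsum_numbering (I := rat) (countableP _) infinite_rat
    (fun _ : rat => proj1 WW).
  by exists L => _; exists W.
have FLO : Q @` aleph1 `<=` LO by move=> _ [c /QP[W [_ _ LOQ _]] <-].
exists (Q @` aleph1); split=> //; first exact: card_image_le.
split=> //; apply: rational_sums_unbounded => // W WW.
have /QP[W' [cW' WW' _ iQ]] : aleph1 (otype W) by exists W.
exists W', (Q (otype W)); split=> //; first by apply/otype_eq.
by exists (otype W) => //; exists W.
Qed.
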